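(* Let $R$ be a commutative Noetherian ring with $1\neq 0$. The following statements hold. (i) A non-zero proper radical ideal $\mathfrak{a}$ of $R$ is linked if and only if $\mathfrak{a}=\bigcap_{\mathfrak{p}\in\Lambda}\mathfrak{p}$ for some $R$-regular sequence $\underline{x}=x_1,\dots,x_n$ and some $\Lambda\subseteq\operatorname{Ass}\frac{R}{(\underline{x})}$. (ii) Every non-zero maximal ideal of $R$ is a linked ideal. Moreover, every non-zero minimal prime ideal of $R$ is a linked ideal. (iii) If $R$ is not reduced, then the nilradical $\sqrt{0}$ is a linked ideal.
   Context: Regular sequences $\underline{x}$ satisfy $(\underline{x})\neq R$ and may be empty (generating the zero ideal). An ideal $\mathfrak{a}$ is linked by an ideal $I$ generated by an $R$-regular sequence if $\mathfrak{a}$ is a non-zero proper ideal containing $I$ and there is a non-zero proper ideal $\mathfrak{b}\supseteq I$ with $\mathfrak{b}=I:_R\mathfrak{a}$ and $\mathfrak{a}=I:_R\mathfrak{b}$. An ideal is called linked if it is linked by some ideal $I$ generated by an $R$-regular sequence. *)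

(* Defs.v *)
From HB Require Import structures.
From mathcomp Require Import all_boot all_algebra.
From mathcomp Require Import boolp classical_sets.

Set Implicit Arguments.
Unset Strict Implicit.
Unset Printing Implicit Defensive.

Import GRing.Theory.

Local Open Scope ring_scope.
Local Open Scope quotient_scope.
Local Open Scope classical_set_scope.

(* The quotient of a module by a submodule.  [submodClosed] does not inherit  *)
(* from [zmodClosed] (it is stated over semirings), hence the wrapper         *)
(* [sub_pred], which carries the missing closure under opposites.             *)
Section QuotientModule.
Variables (R : pzRingType) (V : lmodType R) (U : submodClosed V).

Definition sub_pred : {pred V} := U.

Fact sub_pred_zmod_closed : zmod_closed sub_pred.
Proof. exact: GRing.submod_closedB (GRing.submodClosedP U). Qed.

HB.instance Definition _ := GRing.isZmodClosed.Build V sub_pred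
  sub_pred_zmod_closed.

Definition quotmod := Quotient.quot sub_pred.

HB.instance Definition _ := GRing.Zmodule.on quotmod.
HB.instance Definition _ := EqQuotient.on quotmod.

Definition quotmod_scale (a : R) (q : quotmod) : quotmod :=
  \pi_quotmod (a *: repr q).

Fact pi_quotmod_eq (u v : V) :
  (\pi_quotmod u == \pi_quotmod v) = (u - v \in sub_pred).
Proof. by rewrite -Quotient.idealrBE. Qed.

Fact pi_quotmodD (u v : V) :
  \pi_quotmod (u + v) = \pi_quotmod u + \pi_quotmod v.
Proof. exact: (@Quotient.pi_add V sub_pred). Qed.

Fact pi_quotmodZ (a : R) (u : V) :
  \pi_quotmod (a *: u) = quotmod_scale a (\pi_quotmod u).
Proof.
apply/eqP; rewrite pi_quotmod_eq -scalerBr; apply: (rpredZ (s := U)).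
by change (u - repr (\pi_quotmod u) \in sub_pred); rewrite -pi_quotmod_eq reprK.
Qed.

Fact quotmod_scaleA a b q :
  quotmod_scale a (quotmod_scale b q) = quotmod_scale (a * b) q.
Proof. by elim/quotW: q => u; rewrite -(pi_quotmodZ b) -!pi_quotmodZ scalerA. Qed.

Fact quotmod_scale1 : left_id 1 quotmod_scale.
Proof. by elim/quotW=> u; rewrite -pi_quotmodZ scale1r. Qed.

Fact quotmod_scaleDr : right_distributive quotmod_scale +%R.
Proof.
move=> a; elim/quotW=> u; elim/quotW=> v.
by rewrite -pi_quotmodD -!pi_quotmodZ scalerDr pi_quotmodD.
Qed.

Fact quotmod_scaleDl q : {morph quotmod_scale^~ q : a b / a + b}.
Proof.
by elim/quotW: q => u a b; rewrite -!pi_quotmodZ scalerDl pi_quotmodD.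
Qed.

HB.instance Definition _ := GRing.Zmodule_isLmodule.Build R quotmod
  quotmod_scaleA quotmod_scale1 quotmod_scaleDr quotmod_scaleDl.

End QuotientModule.

(* Ideals, not necessarily proper: the submodules of the regular module.  The *)
(* library's [idealr] consists of proper ideals only.                         *)
Notation ideal R := (submodClosed (GRing.regular R)).

Section Ideals.
Variable R : comNzRingType.
Implicit Types (I a b p q : ideal R) (x : seq R).

Definition zero_ideal : {pred R^o} := pred1 0.

Fact zero_ideal_closed : submod_closed zero_ideal.
Proof.
split=> [|r u v]; rewrite !inE // => /eqP-> /eqP->.
by rewrite scaler0 addr0.
Qed.
HB.instance Definition _ := GRing.isSubmodClosed.Build R R^o zero_ideal
  zero_ideal_closed.

Definition ideal_gen x : {pred R^o} :=
  fun r => `[< exists c : 'I_(size x) -> R, r = \sum_i c i * x`_i >].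

Fact ideal_gen_closed x : submod_closed (ideal_gen x).
Proof.
split=> [|r u v]; rewrite !unfold_in.
  by apply/asboolP; exists (fun=> 0); rewrite big1 // => i _; rewrite mul0r.
move=> /asboolP[c ->] /asboolP[d ->]; apply/asboolP.
exists (fun i => r * c i + d i).
under [RHS]eq_bigr do rewrite mulrDl -mulrA.
by rewrite big_split -mulr_sumr.
Qed.
HB.instance Definition _ x := GRing.isSubmodClosed.Build R R^o (ideal_gen x)
  (ideal_gen_closed x).

Definition colon I a : {pred R^o} :=
  fun r => `[< forall s : R, s \in a -> r * s \in I >].

Fact colon_closed I a : submod_closed (colon I a).
Proof.
split=> [|r u v]; rewrite !unfold_in.
  by apply/asboolP => s _; rewrite mul0r; exact: (@rpred0 _ I).
move=> /asboolP uI /asboolP vI; apply/asboolP => s sa.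
rewrite mulrDl -mulrA; apply: (@rpredD _ I); last exact: vI.
by apply: (rpredZ (s := I)); exact: uI.
Qed.
HB.instance Definition _ I a := GRing.isSubmodClosed.Build R R^o (colon I a)
  (colon_closed I a).

Definition radical I : {pred R^o} :=
  fun r => `[< exists n : nat, (r : R) ^+ n \in I >].

Fact radical_closed I : submod_closed (radical I).
Proof.
have IM (s t : R) : t \in I -> s * t \in I by move=> tI; exact: (rpredZ (s := I)).
split=> [|r u v]; rewrite !unfold_in.
  by apply/asboolP; exists 1%N; rewrite expr1; exact: (@rpred0 _ I).
move=> /asboolP[m um] /asboolP[n vn]; apply/asboolP; exists (m + n)%N.
have rum : (r *: u : R) ^+ m \in I by rewrite (@exprMn R); apply/IM.
rewrite (@exprDn R); apply: (@rpred_sum _ I) => i _.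
rewrite -mulr_natl; apply/IM.
have [le_in|lt_ni] := leqP i n.
  by rewrite -addnBA // exprD -mulrA mulrC; apply/IM.
apply/IM; rewrite -(subnK (ltnW lt_ni)) exprD; exact/IM.
Qed.
HB.instance Definition _ I := GRing.isSubmodClosed.Build R R^o (radical I)
  (radical_closed I).

Definition nilradical : {pred R^o} := radical zero_ideal.
HB.instance Definition _ := GRing.SubmodClosed.on nilradical.

Definition nonzero_ideal a := ~ (a =i zero_ideal).
Definition is_proper a := ~ (a =i predT).
Definition is_radical a := radical a =i a.
Definition is_prime p := is_proper p /\ prime_idealr_closed (p : {pred R}).
Definition is_maximal a :=
  is_proper a /\ forall b, is_proper b -> {subset a <= b} -> b =i a.
Definition is_minimal_prime p :=
  is_prime p /\ forall q, is_prime q -> {subset q <= p} -> q =i p.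

Definition noetherian := forall a, exists x, a =i ideal_gen x.
Definition reduced := forall (r : R) (n : nat), r ^+ n = 0 -> r = 0.

Definition Ass (M : lmodType R) : set (ideal R) :=
  [set p | is_prime p /\
           exists m : M, forall r : R, r \in p <-> r *: m = 0].

Definition regular_elt (M : lmodType R) (r : R) :=
  forall m : M, r *: m = 0 -> m = 0.

Definition regular_seq x :=
  is_proper (ideal_gen x) /\
  forall i, (i < size x)%N ->
    regular_elt (quotmod (ideal_gen (take i x))) x`_i.

Definition linked_by I a :=
  [/\ nonzero_ideal a, is_proper a, {subset I <= a} &
      exists b, [/\ nonzero_ideal b, is_proper b, {subset I <= b},
                    b =i colon I a & a =i colon I b]].

Definition linked a := exists x, regular_seq x /\ linked_by (ideal_gen x) a.

End Ideals.

Arguments noetherian R : clear implicits.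
Arguments reduced R : clear implicits.
Arguments nilradical R : clear implicits.

(* Main.v *)
(* If [a = I : C] for an ideal [I] generated by a regular sequence and a set  *)
(* [C], then [I : (I : a) = a], so [b = I : a] links [a] by [I] unless        *)
(* [a = I]; in that case one squares the last element of the sequence.        *)
(* Intersections of associated primes of [R/I] have this form.  Conversely,   *)
(* if [a = I : b] is radical and [r] is not in [a], then an ideal [I : y]     *)
(* with [y] in [b], maximal among those with no [r^n y] in [I], is an         *)
(* associated prime of [R/I] that contains [a] but not [r].  The same         *)
(* maximality argument shows that minimal primes are annihilators of          *)
(* elements.  A maximal ideal is of the form [I : y] when [I] is generated by *)
(* a maximal regular sequence in it, as it then consists of zero divisors on  *)
(* [R/I].                                                                     *)
From HB Require Import structures.
Require Import Defs.
From mathcomp Require Import all_boot all_algebra.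
From mathcomp Require Import boolp classical_sets.

Import GRing.Theory.
Local Open Scope ring_scope.
Local Open Scope quotient_scope.
Local Open Scope classical_set_scope.

(** Everything reduces to the criterion [linked_of_colon]: a non-zero proper ideal of the form
    [I : C], with [I] generated by a regular sequence, is linked. The primes needed are colons
    [I : y] that are maximal under a constraint on [y] ([prime_colon_elt_max]). Avoiding the powers
    of [r], they cut out any radical ideal [I : b] ([prime_colon_elt_avoid]); for [I = 0] they cut
    out the nilradical. Avoiding the complement of a minimal prime, they give that prime itself
    ([minimal_prime_ann]). For a maximal ideal, [regular_seq_max] makes it consist of zero divisors
    modulo [I], and [zero_divisors_colon_elt], by prime avoidance, puts it inside a single proper
    [I : y]. *)

Section Ideals.
Context {R : comNzRingType}.
Implicit Types (I J a b p : ideal R) (r s y z : R) (x : seq R).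

(** * Elementary ideal theory *)

Lemma ideal0 I : (0 : R) \in I.
Proof. exact: (@rpred0 _ I). Qed.

Lemma idealD I r s : r \in I -> s \in I -> r + s \in I.
Proof. exact: (@rpredD _ I). Qed.

Lemma idealMl I r s : s \in I -> r * s \in I.
Proof. by move=> sI; apply: (rpredZ (s := I)). Qed.

Lemma idealMr I r s : r \in I -> r * s \in I.
Proof. by rewrite mulrC; apply: idealMl. Qed.

Lemma idealB I r s : r \in I -> s \in I -> r - s \in I.
Proof. by move=> rI sI; rewrite -mulN1r; apply/idealD/idealMl. Qed.

Lemma ideal_sum I n (F : 'I_n -> R) :
  (forall i, F i \in I) -> \sum_i F i \in I.
Proof. by move=> FI; apply: (@rpred_sum _ I) => i _. Qed.

Lemma proper1 I : is_proper I <-> (1 : R) \notin I.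
Proof.
split=> [propI|/negP I1 eqI]; last by apply: I1; rewrite eqI.
apply/negP => I1; apply: propI => r; rewrite [RHS]inE.
by have := @idealMl I r 1 I1; rewrite mulr1.
Qed.

Lemma proper_sub I J : {subset I <= J} -> is_proper J -> is_proper I.
Proof. by move=> IJ /proper1 J1; apply/proper1; apply: contra J1; apply: IJ. Qed.

Lemma nonzeroP I : nonzero_ideal I <-> exists2 r : R, r \in I & r != 0.
Proof.
split=> [nzI|[r rI r0] eqI]; last by move: rI; rewrite eqI; apply/negP.
apply: contrapT => noI; apply: nzI => r; apply/idP/eqP => [rI|->].
  by apply: contrapT => /eqP r0; apply: noI; exists r.
exact: ideal0.
Qed.

Lemma primeM {p} r s : is_prime p -> r * s \in p -> r \in p \/ s \in p.
Proof. by case=> _ /[apply] /orP. Qed.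

Lemma primeX {p} r n : is_prime p -> r ^+ n \in p -> r \in p.
Proof.
move=> pp; elim: n => [|n IHn]; last by rewrite exprS => /(primeM _ _ pp)[].
by rewrite expr0 => p1; case: pp => /proper1; rewrite p1.
Qed.

Lemma mem_colon I a r :
  reflect (forall s, s \in a -> r * s \in I) (r \in colon I a).
Proof. by rewrite unfold_in; apply: asboolP. Qed.

(** Coefficients are indexed by [nat], so that their type does not change when a generator is
    appended. *)
Lemma mem_ideal_gen x r :
  reflect (exists c : nat -> R, r = \sum_(i < size x) c i * x`_i)
          (r \in ideal_gen x).
Proof.
rewrite unfold_in; apply: (iffP (asboolP _)) => -[c ->]; last by exists (fun i => c i).
exists (fun k => if insub k is Some i then c i else 0).
by apply: eq_bigr => i _; rewrite valK.
Qed.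

Lemma ideal_gen_sub I x : {subset x <= I} -> {subset ideal_gen x <= I}.
Proof.
move=> xI r /mem_ideal_gen[c ->]; apply: ideal_sum => i.
by apply/idealMl/xI/mem_nth.
Qed.

Lemma ideal_gen_rcons x y r :
  r \in ideal_gen (rcons x y) <-> exists c, r - c * y \in ideal_gen x.
Proof.
have sumE (c : nat -> R) :
    \sum_(i < size (rcons x y)) c i * (rcons x y)`_i
    = \sum_(i < size x) c i * x`_i + c (size x) * y.
  rewrite size_rcons big_ord_recr /= nth_rcons ltnn eqxx; congr (_ + _).
  by apply: eq_bigr => i _; rewrite nth_rcons ltn_ord.
split=> [/mem_ideal_gen[c ->]|[d /mem_ideal_gen[c eqr]]].
  by exists (c (size x)); rewrite sumE addrK; apply/mem_ideal_gen; exists c.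
apply/mem_ideal_gen.
pose c' k := if (k < size x)%N then c k else d.
exists c'; rewrite sumE /c' ltnn -(subrK (d * y) r) eqr; congr (_ + _).
by apply: eq_bigr => i _; rewrite ltn_ord.
Qed.

Lemma ideal_gen_nil r : (r \in ideal_gen [::]) = (r == 0).
Proof.
apply/idP/eqP => [/mem_ideal_gen[c ->]|->]; first by rewrite big_ord0.
exact: (ideal0 (ideal_gen [::])).
Qed.

Lemma sub_ideal_gen x : {subset x <= ideal_gen x}.
Proof.
elim/last_ind: x => // x y IHx z; rewrite mem_rcons inE => zxy.
apply/ideal_gen_rcons; case/predU1P: zxy => [->|/IHx zx].
  by exists 1; rewrite mul1r subrr; apply: (ideal0 (ideal_gen x)).
by exists 0; rewrite mul0r subr0.
Qed.

Lemma ideal_gen_catl x x' : {subset ideal_gen x <= ideal_gen (x ++ x')}.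
Proof.
by apply: ideal_gen_sub => z zx; apply: sub_ideal_gen; rewrite mem_cat zx.
Qed.

Lemma ideal_gen_catr x x' : {subset ideal_gen x' <= ideal_gen (x ++ x')}.
Proof.
by apply: ideal_gen_sub => z zx; apply: sub_ideal_gen; rewrite mem_cat zx orbT.
Qed.

(** Serves to extract, by noetherianity, finitely many generators from an arbitrary set. *)
Definition ideal_span (X : set R) : {pred R^o} :=
  fun r => `[< exists2 x : seq R, {in x, forall y, X y} & r \in ideal_gen x >].

Fact ideal_span_closed X : submod_closed (ideal_span X).
Proof.
split=> [|r u v]; rewrite !unfold_in.
  by apply/asboolP; exists [::] => //; apply: (ideal0 (ideal_gen [::])).
move=> /asboolP[x Xx ux] /asboolP[x' Xx' vx']; apply/asboolP.
exists (x ++ x') => [y|]; first by rewrite mem_cat => /orP[/Xx|/Xx'].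
apply: (idealD (ideal_gen _)); last exact: ideal_gen_catr.
by apply: (idealMl (ideal_gen _)); apply: ideal_gen_catl.
Qed.
HB.instance Definition _ X := GRing.isSubmodClosed.Build R R^o (ideal_span X)
  (ideal_span_closed X).

Definition colon_elt I y : {pred R^o} := colon I (ideal_gen [:: y]).
HB.instance Definition _ I y := GRing.SubmodClosed.on (colon_elt I y).

Lemma mem_colon_elt I y r : (r \in colon_elt I y) = (r * y \in I).
Proof.
apply/mem_colon/idP => [|ryI]; first by apply; apply: sub_ideal_gen (mem_head _ _).
move=> s /(ideal_gen_rcons [::])[c]; rewrite ideal_gen_nil subr_eq0 => /eqP->.
by rewrite mulrCA; apply: idealMl.
Qed.

(** * Associated primes and regular sequences in terms of ideals *)

Lemma pi_quotmod_eq0 I s : \pi_(quotmod I) s = 0 <-> s \in I.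
Proof.
have pi0 : \pi_(quotmod I) 0 = 0.
  by apply: (addrI (\pi_(quotmod I) 0)); rewrite -pi_quotmodD !addr0.
split=> [/eqP|sI].
  by rewrite -pi0 pi_quotmod_eq subr0.
by apply/eqP; rewrite -pi0 pi_quotmod_eq subr0.
Qed.

Lemma scale_pi_quotmod I r s : r *: \pi_(quotmod I) s = \pi_(quotmod I) (r * s).
Proof. by rewrite (pi_quotmodZ I r s). Qed.

Lemma regular_eltP I r :
  regular_elt (quotmod I) r <-> forall s, r * s \in I -> s \in I.
Proof.
split=> [regr s rsI|regr m].
  by apply/pi_quotmod_eq0/regr; rewrite scale_pi_quotmod; apply/pi_quotmod_eq0.
elim/quotW: m => s; rewrite scale_pi_quotmod => /pi_quotmod_eq0/regr sI.
exact/pi_quotmod_eq0.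
Qed.

Lemma AssP I p :
  Ass (quotmod I) p <-> is_prime p /\ exists y, p =i colon_elt I y.
Proof.
split=> -[pp]; last first.
  case=> y eqp; split=> //; exists (\pi_(quotmod I) y) => r.
  by rewrite eqp mem_colon_elt scale_pi_quotmod pi_quotmod_eq0.
case; elim/quotW=> y eqp; split=> //; exists y => r; rewrite mem_colon_elt.
apply/idP/idP => [/eqp|ryI].
  by rewrite scale_pi_quotmod => /pi_quotmod_eq0.
by apply/eqp; rewrite scale_pi_quotmod; apply/pi_quotmod_eq0.
Qed.

Lemma regular_seq_nil : regular_seq ([::] : seq R).
Proof. by split=> //; apply/proper1; rewrite ideal_gen_nil oner_eq0. Qed.

Lemma regular_seq_rcons x y :
  regular_seq (rcons x y) <->
  [/\ regular_seq x, is_proper (ideal_gen (rcons x y)) &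
      forall s, y * s \in ideal_gen x -> s \in ideal_gen x].
Proof.
have sub : {subset ideal_gen x <= ideal_gen (rcons x y)}.
  by rewrite -cats1; apply: ideal_gen_catl.
split=> [[prop reg]|[[_ regx] prop regy]].
  split=> //; first split.
  - exact: proper_sub prop.
  - move=> i ltix; have := reg i; rewrite size_rcons (leqW ltix).
    move=> /(_ isT)/regular_eltP; rewrite nth_rcons ltix.
    by rewrite -cats1 takel_cat ?(ltnW ltix) // => regi; apply/regular_eltP.
  have := reg (size x); rewrite size_rcons ltnSn => /(_ isT)/regular_eltP.
  by rewrite nth_rcons ltnn eqxx -cats1 take_size_cat.
split=> // i; rewrite size_rcons ltnS leq_eqVlt nth_rcons => /predU1P[->|ltix].
  apply/regular_eltP; rewrite ltnn eqxx -cats1 take_size_cat //.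
rewrite ltix; apply/regular_eltP; rewrite -cats1 takel_cat ?(ltnW ltix) //.
exact/regular_eltP/regx.
Qed.

(** * Linkage from a colon presentation *)

(** Since [C] lies in [b = I : a], the colon [I : b] lies in [I : C = a]; the other inclusion is
    automatic. The ideal [b] is non-zero because [a] is proper, and proper because [a] is not inside
    [I]. *)
Lemma linked_of_colon_nsub x a (C : set R) :
  regular_seq x -> is_proper a -> ~ {subset a <= ideal_gen x} ->
  (forall r, r \in a <-> forall c, C c -> r * c \in ideal_gen x) ->
  linked a.
Proof.
set I := ideal_gen x => regx propa naI aE; exists x; split=> //.
have Ia : {subset I <= a} by move=> r rI; apply/aE => c _; apply: (idealMr I).
have Cb c : C c -> c \in colon I a.
  by move=> Cc; apply/mem_colon => s /aE/(_ c Cc); rewrite mulrC.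
have [c Cc cI] : exists2 c, C c & c \notin I.
  apply: contrapT => noC; apply: propa => r; apply/idP; rewrite inE.
  apply/aE => c Cc; apply: (idealMl I); apply: contrapT => /negP cI.
  by apply: noC; exists c.
split=> //.
  apply/nonzeroP; apply: contrapT => noa; apply: naI => r ra.
  have [->|r0] := eqVneq r 0; first exact: (ideal0 I).
  by case: noa; exists r.
exists (colon I a : ideal R); split=> //.
- apply/nonzeroP; exists c; first exact: Cb.
  by apply: contraNneq cI => ->; apply: (ideal0 I).
- move=> eqb; apply: naI => r ra.
  have /mem_colon/(_ r ra) : 1 \in colon I a by rewrite eqb.
  by rewrite mul1r.
- by move=> r rI; apply/mem_colon => s _; apply: (idealMr I).
move=> r; apply/idP/mem_colon => [ra s /mem_colon/(_ r ra)|rb].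
  by rewrite mulrC.
by apply/aE => c' /Cb/rb.
Qed.

(* [(x_1, ..., x_n)] is the colon of [(x_1, ..., x_(n-1), x_n^2)] by [x_n]. *)
Lemma linked_regular_seq x a :
  regular_seq x -> nonzero_ideal a -> a =i ideal_gen x -> linked a.
Proof.
case/lastP: x => [_ nza eqa|x y].
  by case: nza => r; rewrite eqa ideal_gen_nil.
move=> /regular_seq_rcons[regx prop regy] nza eqa.
have aE r : r \in a <-> r * y \in ideal_gen (rcons x (y ^+ 2)).
  rewrite eqa; split=> [/ideal_gen_rcons[c rcy]|/ideal_gen_rcons[c]].
    apply/ideal_gen_rcons; exists c; rewrite expr2 mulrA -mulrBl.
    exact: (idealMr (ideal_gen x)).
  rewrite expr2 mulrA -mulrBl mulrC => /regy rcy.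
  by apply/ideal_gen_rcons; exists c.
have sub : {subset ideal_gen (rcons x (y ^+ 2)) <= ideal_gen (rcons x y)}.
  move=> r /ideal_gen_rcons[c]; rewrite expr2 mulrA => rcy.
  by apply/ideal_gen_rcons; exists (c * y).
have propa : is_proper a by apply: proper_sub prop => r; rewrite eqa.
apply: (@linked_of_colon_nsub (rcons x (y ^+ 2)) a [set y]) => //.
- apply/regular_seq_rcons; split=> // [|s]; first exact: proper_sub prop.
  by rewrite expr2 -mulrA => /regy/regy.
(* If [a] were inside the smaller ideal, then so would be [y = 1 * y], and [aE] would put 1 in
   [a]. *)
- move=> aI; have ya : y \in a.
    by rewrite eqa; apply: sub_ideal_gen; rewrite mem_rcons mem_head.
  have /aE : 1 * y \in ideal_gen (rcons x (y ^+ 2)) by rewrite mul1r; apply: aI.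
  by apply/negP/proper1.
move=> r; split=> [/aE ry _ -> //|]; by move/(_ y erefl)/aE.
Qed.

Lemma linked_of_colon x a (C : set R) :
  regular_seq x -> nonzero_ideal a -> is_proper a ->
  (forall r, r \in a <-> forall c, C c -> r * c \in ideal_gen x) ->
  linked a.
Proof.
move=> regx nza propa aE.
have [aI|naI] := pselect {subset a <= ideal_gen x}; last first.
  exact: linked_of_colon_nsub naI aE.
apply: (@linked_regular_seq x) => // r; apply/idP/idP => [/aI //|rI].
by apply/aE => c _; apply: (idealMr (ideal_gen x)).
Qed.

(** * Finite generation and maximal elements *)

Hypothesis noethR : noetherian R.

Lemma noetherian_span (X : set R) :
  exists2 x : seq R, {in x, forall y, X y} & forall y, X y -> y \in ideal_gen x.
Proof.
have [w eqw] := noethR (ideal_span X).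
have spanX y : X y -> y \in ideal_span X.
  move=> Xy; rewrite unfold_in; apply/asboolP; exists [:: y].
    by move=> z; rewrite inE => /eqP->.
  exact: sub_ideal_gen (mem_head _ _).
have [x Xx wx] : exists2 x : seq R,
    {in x, forall y, X y} & {subset w <= ideal_gen x}.
  have : {subset w <= ideal_span X} by move=> y yw; rewrite eqw sub_ideal_gen.
  elim: w {eqw} => [|y w IHw] sub; first by exists [::].
  have [z zw|x Xx wx] := IHw; first by apply: sub; rewrite inE zw orbT.
  have := sub y (mem_head _ _); rewrite unfold_in => /asboolP[x' Xx' yx'].
  exists (x ++ x') => z; first by rewrite mem_cat => /orP[/Xx|/Xx'].
  rewrite inE => /predU1P[->|/wx]; first exact: ideal_gen_catr.
  exact: ideal_gen_catl.
exists x => // y /spanX; rewrite eqw; exact: ideal_gen_sub.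
Qed.

(** Otherwise dependent choice builds a strictly ascending chain of ideals [F t]; the span of its
    union is finitely generated, hence reached at a finite stage. Maximizing over indices [t] keeps
    the witness [t] at hand. *)
Lemma noetherian_max (T : Type) (P : T -> Prop) (F : T -> ideal R) t0 :
  P t0 -> exists t, [/\ P t, {subset F t0 <= F t} &
    forall t', P t' -> {subset F t <= F t'} -> {subset F t' <= F t}].
Proof.
move=> Pt0; apply: contrapT => nomax.
pose Q t := P t /\ {subset F t0 <= F t}.
have /choice[g gP] t : exists t', Q t ->
    [/\ Q t', {subset F t <= F t'} & ~ {subset F t' <= F t}].
  have [Qt|nQt] := pselect (Q t); last by exists t.
  apply: contrapT => noext; apply: nomax; exists t; case: (Qt) => Pt sub.
  split=> // t' Pt' tt'; apply: contrapT => ntt'.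
  apply: noext; exists t' => _; split=> //; split=> // r /sub; exact: tt'.
pose f n := iter n g t0.
have Qf n : Q (f n) by elim: n => [|n /gP[]//]; split.
have fmono m n : (m <= n)%N -> {subset F (f m) <= F (f n)}.
  move=> /subnK <-; elim: (n - m)%N => // k IHk r /IHk.
  by have [_ + _] := gP _ (Qf (k + m)%N); apply.
have [x Xx xgen] := noetherian_span [set r | exists n, r \in F (f n)].
have [N xN] : exists N, {subset x <= F (f N)}.
  elim: x Xx {xgen} => [|y x IHx] Xx; first by exists 0%N.
  have [z zx|N xN] := IHx; first by apply: Xx; rewrite inE zx orbT.
  have [n yn] := Xx y (mem_head _ _).
  exists (maxn n N) => z; rewrite inE => /predU1P[->|/xN].
    exact: fmono (leq_maxl _ _) _ yn.
  exact: fmono (leq_maxr _ _) _.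
have [_ _] := gP _ (Qf N); apply=> r rN; apply: (@ideal_gen_sub (F (f N)) x) => //.
by apply: xgen; exists N.+1.
Qed.

Definition mul_system (S : set R) :=
  S 1 /\ forall s t, S s -> S t -> S (s * t).

(** * Prime ideals of the form [I : z] *)

(** Choose [I : z] maximal. If [u * v] is in [I : z] and [u] is not, then [u * z] is still
    admissible, so [I : u z] equals [I : z]; it contains [v]. *)
Lemma prime_colon_elt_max I b (S : set R) y :
  mul_system S -> y \in b -> (forall s, S s -> s * y \notin I) ->
  exists z, [/\ z \in b, (forall s, S s -> s * z \notin I),
    is_prime (colon_elt I z), {subset colon_elt I y <= colon_elt I z} &
    forall z', z' \in b -> (forall s, S s -> s * z' \notin I) ->
      {subset colon_elt I z <= colon_elt I z'} ->
      {subset colon_elt I z' <= colon_elt I z}].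
Proof.
move=> [S1 SM] yb yS.
have [z [[zb zS] yz zmax]] := @noetherian_max R
  (fun z => z \in b /\ forall s, S s -> s * z \notin I) (colon_elt I) y
  (conj yb yS).
exists z; split=> //; last by move=> z' z'b z'S; apply: zmax.
split; first by apply/proper1; rewrite mem_colon_elt; apply: zS.
move=> u v; rewrite (mem_colon_elt I z (u * v)) => uvz.
apply/orP; have [uz|uz] := boolP (u \in colon_elt I z); [by left | right].
apply: (zmax (u * z)).
- split=> [|s Ss]; first exact: idealMl.
  (* Otherwise [u] lies in [I : s z], which equals [I : z] by maximality. *)
  apply: contra uz => suz; apply: (zmax (s * z)).
  + split=> [|t St]; first exact: idealMl.
    by rewrite mulrA; apply/zS/SM.
  + move=> r; rewrite !mem_colon_elt => rz.
    by rewrite mulrCA; apply: idealMl.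
  + by rewrite mem_colon_elt mulrCA.
- move=> r; rewrite !mem_colon_elt => rz.
  by rewrite mulrCA; apply: idealMl.
by rewrite mem_colon_elt mulrA [v * u]mulrC.
Qed.

Lemma mul_system_exp r : mul_system [set r ^+ n | n in setT].
Proof.
split=> [|_ _ [m _ <-] [n _ <-]]; first by exists 0%N => //; rewrite expr0.
by exists (m + n)%N => //; rewrite exprD.
Qed.

(** One exponent works for all of [b], because [b] is finitely generated. *)
Lemma expr_mul_mem I b r :
  (forall y, y \in b -> exists n, r ^+ n * y \in I) ->
  exists n, r ^+ n \in colon I b.
Proof.
have [x eqb] := noethR b => tors.
have [N xN] : exists N, {subset x <= colon_elt I (r ^+ N)}.
  have : {subset x <= b} by move=> y yx; rewrite eqb sub_ideal_gen.
  elim: x {eqb} => [|y x IHx] sub; first by exists 0%N.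
  have [z zx|N xN] := IHx; first by apply: sub; rewrite inE zx orbT.
  have [n yn] := tors y (sub y (mem_head _ _)).
  exists (n + N)%N => z; rewrite inE mem_colon_elt => /predU1P[->|/xN].
    by rewrite exprD mulrA [y * _]mulrC; apply: idealMr.
  by rewrite mem_colon_elt exprD mulrCA => zN; apply: idealMl.
exists N; apply/mem_colon => s; rewrite eqb => /(ideal_gen_sub _ _ xN).
by rewrite mem_colon_elt mulrC.
Qed.

Lemma prime_colon_elt_avoid I b r :
  (forall n, r ^+ n \notin colon I b) ->
  exists y, [/\ y \in b, is_prime (colon_elt I y) & r \notin colon_elt I y].
Proof.
move=> rnb.
have [y yb yS] : exists2 y, y \in b & forall n, r ^+ n * y \notin I.
  apply: contrapT => tors.
  have [y yb|n] := expr_mul_mem I b r; last exact/negP.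
  apply: contrapT => ny; apply: tors; exists y => // n.
  by apply/negP => yn; apply: ny; exists n.
have yS' s : [set r ^+ n | n in setT] s -> s * y \notin I by case=> n _ <-.
have [z [zb zS zp _ _]] :=
  prime_colon_elt_max I b _ y (mul_system_exp r) yb yS'.
by exists z; split=> //; rewrite mem_colon_elt; apply: zS; exists 1%N.
Qed.

(** With [S] the complement of [p], the prime [0 : z] misses [S], so it lies in [p] and equals it by
    minimality. *)
Lemma minimal_prime_ann p :
  is_minimal_prime p -> exists y, p =i colon_elt (ideal_gen [::]) y.
Proof.
move=> [pp pmin].
have Smul : mul_system [set s | s \notin p].
  split=> [|s t /negP sp /negP tp]; first exact/proper1/(proj1 pp).
  by apply/negP => /(primeM _ _ pp)[].
have yS s : [set s | s \notin p] s -> s * 1 \notin ideal_gen [::].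
  by rewrite mulr1 ideal_gen_nil; apply: contraNneq => ->; apply: ideal0.
have [z [_ zS zp _ _]] :=
  prime_colon_elt_max _ _ _ 1 Smul (sub_ideal_gen _ _ (mem_head _ [::])) yS.
exists z => r; rewrite (pmin (colon_elt (ideal_gen [::]) z)) // => s.
by rewrite mem_colon_elt => sz; apply/negPn/negP => /zS/negP.
Qed.

(** * Prime avoidance and ideals of zero divisors *)

Lemma prime_not_contains_cap p (T : eqType) (F : T -> ideal R) (ws : seq T) :
  is_prime p -> {in ws, forall w, ~ {subset F w <= p}} ->
  exists2 t : R, t \notin p & {in ws, forall w, t \in F w}.
Proof.
move=> pp; elim: ws => [|w ws IHws] nsub.
  by exists 1 => //; apply/proper1/(proj1 pp).
have [v vws|t tp tF] := IHws; first by apply: nsub; rewrite inE vws orbT.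
have [u uw up] : exists2 u : R, u \in F w & u \notin p.
  apply: contrapT => nou; apply: (nsub w (mem_head _ _)) => u uw.
  by apply/negPn/negP => up; apply: nou; exists u.
exists (u * t); first by apply/negP => /(primeM _ _ pp)[]; apply/negP.
move=> v; rewrite inE => /predU1P[->|/tF]; first exact: idealMr.
exact: idealMl.
Qed.

(** The second hypothesis says that distinct primes of the list are incomparable; repetitions are
    allowed. *)
Lemma prime_avoidance J (T : eqType) (F : T -> ideal R) (ws : seq T) :
  {in ws, forall w, is_prime (F w)} ->
  {in ws &, forall v w, {subset F v <= F w} -> {subset F w <= F v}} ->
  {in ws, forall w, ~ {subset J <= F w}} ->
  exists2 r : R, r \in J & {in ws, forall w, r \notin F w}.
Proof.
elim: ws => [|w ws IHws] pF incF nsub; first by exists 0; first exact: ideal0.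
have sws v : v \in ws -> v \in w :: ws by rewrite inE orbC => ->.
have [v /sws/pF //|v v' /sws vw /sws|v /sws/nsub //|r rJ rF] := IHws.
  exact: incF.
have [rw|rw] := boolP (r \in F w); last first.
  by exists r => // v; rewrite inE => /predU1P[->|/rF].
(* An inclusion of some [F v] in [F w] would be an equality, putting [r] in [F v]. *)
have [v vws vw|t tw tF] := prime_not_contains_cap (F w) _ F ws (pF w (mem_head _ _)).
  have := incF v w (sws v vws) (mem_head _ _) vw r rw.
  exact/negP/rF.
have [j jJ jw] : exists2 j : R, j \in J & j \notin F w.
  apply: contrapT => noj; apply: (nsub w (mem_head _ _)) => j jJ.
  by apply/negPn/negP => jw; apply: noj; exists j.
(* This is [j * t], non-zero, modulo [F w], and [r] modulo the other primes. *)
exists (r + j * t); first exact/idealD/idealMr.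
move=> v; rewrite inE => /predU1P[->|vws]; apply/negP => rjt.
  have : j * t \in F w by rewrite -[j * t](addKr r) addrC; apply: idealB.
  by case/(primeM _ _ (pF w (mem_head _ _))); apply/negP.
move: (rF v vws); rewrite -[r](addrK (j * t)) => /negP[].
by apply: idealB => //; apply/idealMl/tF.
Qed.

(* The maximal ideals of the form [I : y] are prime and, by noetherianity,    *)
(* finitely many: if [y_1, ..., y_k] generate the span of all such [y], then  *)
(* [I : y] contains the intersection of the [I : y_i], hence one of them.     *)
Lemma zero_divisors_colon_elt I J :
  (forall r, r \in J -> exists2 s, s \notin I & r * s \in I) ->
  exists2 y, y \notin I & {subset J <= colon_elt I y}.
Proof.
move=> zdJ; pose X := [set y | [/\ y \notin I, is_prime (colon_elt I y) &
  forall z, z \notin I -> {subset colon_elt I y <= colon_elt I z} ->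
    {subset colon_elt I z <= colon_elt I y}]].
have Xcover r : r \in J -> exists2 y, X y & r \in colon_elt I y.
  move=> /zdJ[s sI rsI].
  (* With [S = {1}] and [b = R], the constraint on [y] is just [y \notin I]. *)
  have mul1 : mul_system [set 1] by split=> // _ _ -> ->; rewrite mulr1.
  have sS t : [set 1] t -> t * s \notin I by move=> ->; rewrite mul1r.
  have full (u : R) : u \in ideal_gen [:: 1].
    by rewrite -[u]mulr1; apply/(idealMl (ideal_gen [:: 1]))/sub_ideal_gen/mem_head.
  have [y [_ yS py sy ymax]] :=
    prime_colon_elt_max I (ideal_gen [:: 1]) _ s mul1 (full s) sS.
  exists y; last by apply: sy; rewrite mem_colon_elt.
  split=> [||z zI]; [|by []|].
    by rewrite -[y]mul1r; apply: yS.
  by apply: ymax => // _ ->; rewrite mul1r.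
have [ws Xws wsX] := noetherian_span X.
have wsmin y : X y ->
    exists2 w, w \in ws & {subset colon_elt I w <= colon_elt I y}.
  move=> Xy; apply: contrapT => now; have [_ py _] := Xy.
  have [w wws wy|t ty tws] :=
    prime_not_contains_cap (colon_elt I y) _ (fun w => colon_elt I w) ws py.
    by apply: now; exists w.
  (* By symmetry, [t] in [I : w] means [w] in [I : t]; so [I : t] contains the generators [ws],
     hence [y]. *)
  case/negP: ty; rewrite mem_colon_elt mulrC -mem_colon_elt.
  apply: (ideal_gen_sub (colon_elt I t)) (wsX y Xy) => w /tws.
  by rewrite !mem_colon_elt mulrC.
apply: contrapT => noy.
have [w /Xws[]//|v w /Xws[vI _ vmax] /Xws[wI _ _]|w /Xws[wI _ _] Jw|r rJ rws] :=
  prime_avoidance J _ (fun w => colon_elt I w) ws.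
- exact: vmax.
- by apply: noy; exists w.
have [y Xy ry] := Xcover r rJ.
have [w wws wy] := wsmin y Xy; have [_ _ wmax] := Xws w wws.
by case/negP: (rws w wws); apply: wmax ry => //; case: Xy.
Qed.

(** * The classes of linked ideals *)

(** Take [(x)] maximal among ideals inside [a] generated by regular sequences. An element [y] of [a]
    regular modulo [(x)] would extend [x], so maximality puts [y = y * 1] in [(x)], and regularity
    then puts 1 there. *)
Lemma regular_seq_max a : is_proper a ->
  exists x, [/\ regular_seq x, {subset ideal_gen x <= a} &
    forall y, y \in a -> exists2 s, s \notin ideal_gen x & y * s \in ideal_gen x].
Proof.
move=> propa.
have [|x [[regx xa] _ xmax]] := @noetherian_max (seq R)
    (fun x => regular_seq x /\ {subset ideal_gen x <= a})
    (fun x => ideal_gen x) [::].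
  split=> [|r]; first exact: regular_seq_nil.
  by rewrite ideal_gen_nil => /eqP->; apply: ideal0.
exists x; split=> // y ya; apply: contrapT => nos.
have regy s : y * s \in ideal_gen x -> s \in ideal_gen x.
  by move=> ys; apply/negPn/negP => sx; apply: nos; exists s.
have xya : {subset ideal_gen (rcons x y) <= a}.
  move=> r /ideal_gen_rcons[c /xa rca]; rewrite -[r](subrK (c * y)).
  by apply: idealD => //; apply: idealMl.
have /regy : y * 1 \in ideal_gen x.
  rewrite mulr1; apply: (xmax (rcons x y)).
  - by split=> //; apply/regular_seq_rcons; split=> //; apply: proper_sub propa.
  - by rewrite -cats1; apply: ideal_gen_catl.
  - by apply: sub_ideal_gen; rewrite mem_rcons mem_head.
by apply/negP/proper1; case: regx.
Qed.

Lemma linked_colon_elt x a y :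
  regular_seq x -> nonzero_ideal a -> is_proper a ->
  a =i colon_elt (ideal_gen x) y -> linked a.
Proof.
move=> regx nza propa eqa; apply: (linked_of_colon x a [set y]) => // r.
rewrite eqa mem_colon_elt; split=> [ry _ ->//|]; exact.
Qed.

Lemma linked_maximal a : nonzero_ideal a -> is_maximal a -> linked a.
Proof.
move=> nza [propa maxa]; have [x [regx xa zda]] := regular_seq_max a propa.
have [y yx ay] := zero_divisors_colon_elt (ideal_gen x) a zda.
apply: (linked_colon_elt x a y) => // r; apply/esym/maxa => //.
by apply/proper1; rewrite mem_colon_elt mul1r.
Qed.

Lemma linked_minimal_prime p : nonzero_ideal p -> is_minimal_prime p -> linked p.
Proof.
move=> nzp minp; have [y eqp] := minimal_prime_ann p minp.
apply: linked_colon_elt regular_seq_nil nzp _ eqp.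
by case: minp => -[].
Qed.

Lemma mem_nilradical r :
  reflect (exists n, r ^+ n = 0) (r \in nilradical R).
Proof.
rewrite unfold_in; apply: (iffP (asboolP _)) => -[n rn]; exists n.
  exact/eqP.
exact/eqP.
Qed.

Lemma linked_nilradical : ~ reduced R -> linked (nilradical R).
Proof.
move=> nred.
(* The nilradical is the intersection of the prime annihilators of elements, that is, [0 : C]. *)
pose C := [set y | is_prime (colon_elt (ideal_gen [::]) y)].
apply: (linked_of_colon [::] _ C regular_seq_nil).
- apply/nonzeroP; apply: contrapT => no; apply: nred => r n rn.
  apply: contrapT => /eqP r0; apply: no; exists r => //.
  by apply/mem_nilradical; exists n.
- apply/proper1/mem_nilradical => -[n /eqP].
  by rewrite expr1n oner_eq0.
move=> r; split=> [/mem_nilradical[n rn] y py|rC].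
  rewrite -mem_colon_elt; apply: (primeX _ n py).
  by rewrite rn; apply: ideal0.
apply: contrapT => rN.
have [n|y [_ py]] := prime_colon_elt_avoid (ideal_gen [::]) (ideal_gen [:: 1]) r.
  apply/mem_colon => /(_ 1 (sub_ideal_gen _ _ (mem_head _ _))).
  rewrite mulr1 ideal_gen_nil => /eqP rn; apply: rN.
  by apply/mem_nilradical; exists n.
by rewrite mem_colon_elt => /negP[]; apply: rC.
Qed.

Lemma linked_radicalP a :
  nonzero_ideal a -> is_proper a -> is_radical a ->
  linked a <->
  exists x : seq R, regular_seq x /\
    exists Lambda : set (ideal R),
      Lambda `<=` Ass (quotmod (ideal_gen x)) /\
      [set` a] = \bigcap_(p in Lambda) [set` p].
Proof.
move=> nza propa rada; split=> [|[x [regx [L [LAss eqa]]]]].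
  case=> x [regx [_ _ _ [b [_ _ _ _ eqa]]]]; exists x; split=> //.
  (* All associated primes containing [a] are taken. For [r] outside [a = I : b], radicality keeps
     every power of [r] outside; this yields a prime [I : y] with [y] in [b], which contains [a] but
     not [r]. *)
  exists [set p | Ass (quotmod (ideal_gen x)) p /\ {subset a <= p}].
  split=> [p []//|]; apply/seteqP; split=> r /=; first by move=> ra p [_]; apply.
  move=> rL; apply: contrapT => ra.
  have [n|y [yb py /negP]] := prime_colon_elt_avoid (ideal_gen x) b r.
    rewrite -eqa; apply/negP => rna; apply: ra; rewrite -rada unfold_in.
    by apply/asboolP; exists n.
  apply; apply: (rL (colon_elt (ideal_gen x) y)); split.
    by apply/AssP; split=> //; exists y.
  move=> s; rewrite eqa => /mem_colon sb.
  by rewrite mem_colon_elt; apply: sb.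
(* Each prime in [L] is some [I : y]; intersecting them amounts to taking the colon by all these
   [y]. *)
pose C := [set y | exists2 p, L p & p =i colon_elt (ideal_gen x) y].
apply: (linked_of_colon x a C) => // r.
have aE : r \in a <-> forall p, L p -> r \in p.
  by change ([set` a] r <-> (\bigcap_(p in L) [set` p]) r); rewrite eqa.
split=> [/aE rL y [p /rL rp eqp]|rC]; first by rewrite -mem_colon_elt -eqp.
apply/aE => p Lp; have [_ [y eqp]] := (AssP _ _).1 (LAss p Lp).
by rewrite eqp mem_colon_elt; apply: rC; exists p.
Qed.

End Ideals.

Theorem corollary2p6 (R : comNzRingType) (noethR : noetherian R) :
  [/\ (forall a : ideal R, nonzero_ideal a -> is_proper a -> is_radical a ->
         (linked a <->
          exists x : seq R, regular_seq x /\
            exists Lambda : set (ideal R),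
              Lambda `<=` Ass (quotmod (ideal_gen x)) /\
              [set` a] = \bigcap_(p in Lambda) [set` p])),
      (forall a : ideal R, nonzero_ideal a -> is_maximal a -> linked a) /\
      (forall p : ideal R, nonzero_ideal p -> is_minimal_prime p -> linked p) &
      (~ reduced R -> linked (nilradical R))].
Proof.
split; last exact: linked_nilradical.
  exact: linked_radicalP.
split; [exact: linked_maximal | exact: linked_minimal_prime].
Qed.
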